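(* Let $k\ge 0$ and $m\ge 1$ be integers and let $s\in\mathbb{C}\setminus\mathbb{Z}$. Then $$\frac{d^{2k}}{ds^{2k}}\left(\frac{1}{\sin^{2m-1}(\pi s)}\right)=\pi^{2k}\sum_{l=0}^{k}\left(\frac{(2m+2l-2)!}{(2m-2)!}\sum_{\substack{(r_0,\dots,r_l)\in\mathbb{N}_0^{l+1}\\ r_0+\cdots+r_l=k-l}}\ \prod_{h=0}^{l}(2m+2h-1)^{2r_h}\right)\frac{(-1)^{k-l}}{\sin^{2m+2l-1}(\pi s)},$$ and $$\frac{d^{2k+1}}{ds^{2k+1}}\left(\frac{1}{\sin^{2m-1}(\pi s)}\right)=\pi^{2k+1}\sum_{l=0}^{k}\left(\frac{(2m+2l-1)!}{(2m-2)!}\sum_{\substack{(r_0,\dots,r_l)\in\mathbb{N}_0^{l+1}\\ r_0+\cdots+r_l=k-l}}\ \prod_{h=0}^{l}(2m+2h-1)^{2r_h}\right)\frac{(-1)^{k+1-l}\cos(\pi s)}{\sin^{2m+2l}(\pi s)}.$$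
   Context: $\mathbb{N}_0$ denotes the set of nonnegative integers; derivatives are complex derivatives in $s$; $x^0=1$. *)

(* Defs.v *)
From HB Require Import structures.
From mathcomp Require Export all_boot all_order all_algebra.
From mathcomp Require Export complex.
From mathcomp Require Export all_classical all_reals all_analysis.

Set Implicit Arguments.
Unset Strict Implicit.
Unset Printing Implicit Defensive.

Import Order.TTheory GRing.Theory Num.Theory.
Export numFieldNormedType.Exports.

Local Open Scope ring_scope.
Local Open Scope complex_scope.

(* The bare type R[i] carries its R-module structure, not the structure of a
   normed space over itself that complex derivatives need.  Bundled as a
   numFieldType, R[i] inherits the latter (with the modulus as norm)
   from numFieldNormedType. *)
Definition Cplx (R : realType) : numFieldType := R[i].

(* The library has exp, cos and sin on a realType only; they are extended to
   R[i] by exp(x + iy) = exp(x) (cos y + i sin y) and Euler's formulas. *)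
Definition cexp (R : realType) (z : Cplx R) : Cplx R :=
  (expR (complex.Re z))%:C *
  (cos (complex.Im z) +i* sin (complex.Im z)).

Definition cI (R : realType) : Cplx R := 0 +i* 1.

Definition csin (R : realType) (z : Cplx R) : Cplx R :=
  (cexp (cI R * z) - cexp (- (cI R * z))) / (2%:R * cI R).

Definition ccos (R : realType) (z : Cplx R) : Cplx R :=
  (cexp (cI R * z) + cexp (- (cI R * z))) / 2%:R.

Definition cpi (R : realType) : Cplx R := (pi : R)%:C.

(* The sum, over all (r_0, ..., r_l) of natural numbers with sum n, of the
   products of the (2m + 2h - 1)^(2 r_h).  Such r_h are at most n, so letting
   them range over 'I_n.+1 loses no tuple. *)
Definition odd_power_sum (m l n : nat) : nat :=
  (\sum_(r : {ffun 'I_l.+1 -> 'I_n.+1} | \sum_(h < l.+1) r h == n)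
     \prod_(h < l.+1) (2 * m + 2 * h - 1) ^ (2 * r h))%N.

(* Main.v *)
Require Import Defs.
From mathcomp Require Import ring lra zify.
Import Order.TTheory GRing.Theory Num.Theory.
Local Open Scope ring_scope.
Local Open Scope classical_set_scope.

(** With [S = sin (pi z)] and [C = cos (pi z)] one has [(1/S^N)' = - pi N C/S^(N+1)] and,
    by [C^2 = 1 - S^2], [(C/S^N)' = pi ((N-1)/S^(N-1) - N/S^(N+1))].  Differentiating
    the claimed formulas term by term therefore gives them at the next order as soon
    as the inner sums [h_l(n)] satisfy [h_l(n+1) = (2m+2l-1)^2 h_l(n) + h_(l-1)(n+1)],
    the recurrence of the complete homogeneous symmetric polynomials of the
    [(2m+2h-1)^2].  The formulas hold on the open set where [S] does not vanish, so
    they can be differentiated again. *)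

(** * Complete homogeneous symmetric polynomials *)

Fixpoint complete_homogeneous (a : nat -> nat) (l n : nat) : nat :=
  if l is l'.+1 then
    (\sum_(j < n.+1) complete_homogeneous a l' j * a l ^ (n - j))%N
  else (a 0 ^ n)%N.

Lemma complete_homogeneous0 a l : complete_homogeneous a l 0 = 1%N.
Proof. by elim: l => [|l IH] //=; rewrite big_ord1 IH. Qed.

(** In the defining sum the last summand, j = n + 1, is free of [a l.+1]; each of the others has a
    factor [a l.+1] to pull out. *)
Lemma complete_homogeneousSS a l n :
  complete_homogeneous a l.+1 n.+1 =
    (a l.+1 * complete_homogeneous a l.+1 n + complete_homogeneous a l n.+1)%N.
Proof.
rewrite /= big_ord_recr /= subnn muln1; congr addn.
rewrite big_distrr; apply: eq_bigr => j _ /=.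
by rewrite subSn ?leq_ord// expnS mulnCA.
Qed.

(* Expanding the product of the truncated geometric series in [a h * 'X]
   enumerates the bounded exponent tuples. *)
Lemma coef_prod_geometric (a : nat -> nat) l n N : (n < N)%N ->
  (\prod_(h < l.+1) \sum_(j < N) (a h ^ j)%N *: 'X^j : {poly nat})`_n =
  complete_homogeneous a l n.
Proof.
have coefg i j : (j < N)%N ->
    (\sum_(j < N) (a i ^ j)%N *: 'X^j : {poly nat})`_j = (a i ^ j)%N.
  by move=> jN; rewrite -(poly_def N (fun j => (a i ^ j)%N)) coef_poly jN.
elim: l n => [|l IH] n nN; first by rewrite big_ord1 coefg.
rewrite big_ord_recr coefM /=; apply: eq_bigr => j _.
by rewrite IH ?coefg// ?(leq_ltn_trans _ nN) ?leq_subr// -ltnS.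
Qed.

(** Expanding the product of sums in [coef_prod_geometric] gives one monomial per function r; its
    coefficient at n survives exactly when the values of r add up to n. Truncating at N = n + 1
    matches the range ['I_n.+1] of the r h. *)
Lemma odd_power_sumE m l n :
  odd_power_sum m l n =
    complete_homogeneous (fun h => (2 * m + 2 * h - 1) ^ 2)%N l n.
Proof.
rewrite -(coef_prod_geometric _ _ _ n.+1)// bigA_distr_bigA coef_sum.
rewrite /odd_power_sum big_mkcond; apply: eq_bigr => r _ /=.
under [in RHS]eq_bigr => h _ do rewrite -mul_polyC.
rewrite big_split /= -rmorph_prod /= prodrXr mul_polyC coefZ coefXn eq_sym.
case: eqP => _; last by rewrite mulr0.
by rewrite mulr1; apply: eq_bigr => h _; rewrite -expnM.
Qed.

(** * The derivative as a linear approximation *)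

Lemma is_derive1P (K : numFieldType) (f : K -> K) (a l : K) :
  is_derive a 1 f l <->
  forall e, 0 < e -> exists2 d, 0 < d &
    forall h, `|h| < d -> `|f (h + a) - f a - l * h| <= e * `|h|.
Proof.
pose q h : K := h^-1 *: (f (h *: 1 + a) - f a).
(* Clearing [h^-1] turns the limit of difference quotients into the stated bound, which at h = 0
   reads 0 <= 0. *)
have qE h : h != 0 -> l - q h = - (h^-1 * (f (h + a) - f a - l * h)).
  move=> h0; rewrite /q [h *: 1]mulr1 [_ *: _]/(_ * _).
  by rewrite mulrBr opprB mulrCA mulVf// mulr1.
split=> [[df dl]|dH].
  have : q @ 0^' --> l by rewrite -dl; exact: df.
  move=> /cvgrPdist_le ql e e0.
  have /nbhs_ballP[d d0 dh] := ql _ e0.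
  exists d => // h hd; have [->|h0] := eqVneq h 0.
    by rewrite add0r subrr mulr0 subrr normr0 mulr0.
  have := dh h; rewrite /= -ball_normE /= sub0r normrN => /(_ hd h0).
  by rewrite qE// normrN normrM normfV ler_pdivrMl ?normr_gt0// [`|h| * _]mulrC.
have ql : q @ 0^' --> l.
  apply/cvgrPdist_le => e e0; have [d d0 dh] := dH _ e0.
  near=> h.
  have h0 : h != 0 by near: h; exact: nbhs_dnbhs_neq.
  rewrite qE// normrN normrM normfV ler_pdivrMl ?normr_gt0// [`|h| * _]mulrC.
  by apply: dh; near: h; exact: dnbhs0_lt.
split; first by apply/cvg_ex; exists l.
exact: cvg_lim.
Unshelve. all: by end_near. Qed.

(** * Zeros of the real sine *)

Lemma sin_pi_int (R : realType) (n : int) : sin (pi * n%:~R) = 0 :> R.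
Proof.
have sinpin k : sin (pi * k%:R) = 0 :> R.
  by rewrite mulr_natr -[_ *+ _]add0r (alternatingn (@sinDpi R)) sin0 mulr0.
by case: n => k; rewrite ?NegzE ?mulrNz -?pmulrn ?mulrN ?sinN sinpin ?oppr0.
Qed.

(** Subtracting the floor n of x keeps the sine at 0, but if x is not n then pi (x - n) lies
    strictly between 0 and pi, where the sine is positive. *)
Lemma sin_pi_eq0 (R : realType) (x : R) :
  sin (pi * x) = 0 -> exists n : int, x = n%:~R.
Proof.
move=> sx; exists (Num.floor x).
have /andP[xl xu] := floor_itv x; move: xu; rewrite intrD => xu.
set n := (Num.floor x)%:~R in xl xu *.
have [//|xn] := eqVneq x n.
have sn : sin (pi * n) = 0 by exact: sin_pi_int.
have : sin (pi * (x - n)) = 0 by rewrite mulrBr sinB sx sn mul0r mulr0 subr0.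
have pi0 := pi_gt0 R; have xn0 : n < x by rewrite lt_neqAle eq_sym xn.
suff /gt_eqF/eqP : 0 < sin (pi * (x - n)) by [].
by apply: sin_gt0_pi; rewrite pmulr_rgt0// subr_gt0 xn0 gtr_pMr// ltrBlDl.
Qed.

(** * The complex exponential and its derivative *)

Section complex_exponential.
Local Open Scope complex_scope.
Context {R : realType}.
Implicit Types z w : Cplx R.

Lemma cexpE (x y : R) :
  cexp (x +i* y : Cplx R) = (expR x * cos y) +i* (expR x * sin y).
Proof. by rewrite /cexp /=; apply/eqP; rewrite eq_complex/= !mul0r subr0 addr0 !eqxx. Qed.

Lemma cexpD z w : cexp (z + w) = cexp z * cexp w.
Proof.
case: z w => [a b] [c d]; rewrite -[LHS]/(cexp ((a + c) +i* (b + d))) !cexpE.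
apply/eqP; rewrite eq_complex /= expRD cosD sinD.
by apply/andP; split; apply/eqP; ring.
Qed.

Lemma cexp0 : cexp (0 : Cplx R) = 1.
Proof. by rewrite cexpE expR0 cos0 sin0 mulr0 mulr1. Qed.

Lemma normc_le_ReIm z : `|z| <= (`|complex.Re z| + `|complex.Im z|)%:C.
Proof.
case: z => x y; rewrite normc_def lecR /= -(ler_pXn2r (n := 2)) ?nnegrE ?addr_ge0//.
rewrite sqr_sqrtr ?addr_ge0 ?sqr_ge0// sqrrD !real_normK ?num_real//.
by rewrite -addrA lerD2l lerDr mulrn_wge0 ?mulr_ge0.
Qed.

Lemma normc_ge_Im z : (`|complex.Im z|)%:C <= `|z|.
Proof.
case: z => x y; rewrite normc_def lecR /= -sqrtr_sqr ler_sqrt ?addr_ge0 ?sqr_ge0//.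
by rewrite lerDr sqr_ge0.
Qed.


Let norm_mul_le (a b A B : R) : `|a| <= A -> `|b| <= B -> `|a * b| <= A * B.
Proof. by move=> aA bB; rewrite normrM ler_pM. Qed.

Lemma is_derive_cexp0 : is_derive (0 : Cplx R) 1 (@cexp R) 1.
Proof.
apply/is_derive1P => -[e i]; rewrite ltcE /= => /andP[/eqP-> e0] {i}.
(* With r = |x + iy| < e1 <= 1, the real part of the error is at most 3 e1 r and the imaginary part
   at most 5 e1 r, whence e / 8. *)
have [e1 [e10 e1e e11]] : exists e1 : R, [/\ 0 < e1, e1 <= e / 8 & e1 <= 1].
  exists (Num.min (e / 8) 1).
  by rewrite lt_min divr_gt0// ltr01 !ge_min !lexx orbT.
have /is_derive1P/(_ _ e10)[d1 d10 H1] := @is_derive_expR R 0.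
have /is_derive1P/(_ _ e10)[d2 d20 H2] := @is_derive_cos R 0.
have /is_derive1P/(_ _ e10)[d3 d30 H3] := @is_derive_sin R 0.
pose d := Num.min (Num.min d1 d2) (Num.min d3 e1).
exists d%:C; first by rewrite ltcR !lt_min d10 d20 d30 e10.
case=> x y; pose r : R := Num.sqrt (x ^+ 2 + y ^+ 2).
have nE : `|x +i* y : Cplx R| = r%:C by exact: normc_def.
have xr : `|x| <= r by rewrite -lecR -nE; exact: (normc_ge_Re (x +i* y)).
have yr : `|y| <= r by rewrite -lecR -nE; exact: (normc_ge_Im (x +i* y)).
rewrite nE ltcR.
rewrite !lt_min => /andP[/andP[rd1 rd2] /andP[rd3 re1]].
move: (H1 _ (le_lt_trans xr rd1)) (H2 _ (le_lt_trans yr rd2)).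
move: (H3 _ (le_lt_trans yr rd3)); rewrite !addr0 expR0 cos0 sin0 oppr0 mul0r.
rewrite !addr0 !mul1r ?subr0 => hs he hc.
have r0 : 0 <= r by exact: sqrtr_ge0.
have {}hs : `|sin y - y| <= e1 * r by apply: le_trans hs _; rewrite ler_pM2l.
have {}he : `|expR x - 1 - x| <= e1 * r by apply: le_trans he _; rewrite ler_pM2l.
have {}hc : `|cos y - 1| <= e1 * r by apply: le_trans hc _; rewrite ler_pM2l.
have hE1 : `|expR x - 1| <= 2 * r.
  rewrite -[expR x - 1](subrK x); apply: le_trans (ler_normD _ _) _; nra.
have hE : `|expR x| <= 3.
  rewrite -[expR x](subrK 1); apply: le_trans (ler_normD _ _) _.
  rewrite normr1; lra.
have hx1 : `|1 + x| <= 2.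
  apply: le_trans (ler_normD _ _) _; rewrite normr1; lra.
rewrite cexp0 cexpE; apply: le_trans (normc_le_ReIm _) _; rewrite /= subr0.
have -> : (e +i* 0 : Cplx R) * r%:C = (e * r)%:C by rewrite rmorphM.
rewrite lecR.
(* Both parts become sums of products of a bounded factor and a small one; in the last product both
   factors are O(r), and one r is bounded by e1. *)
have -> : expR x * cos y - 1 - x =
    (expR x - 1 - x) * cos y + (1 + x) * (cos y - 1) by ring.
have -> : expR x * sin y - y = expR x * (sin y - y) + (expR x - 1) * y by ring.
have := norm_mul_le _ _ _ _ he (cos_max y).
have := norm_mul_le _ _ _ _ hx1 hc.
have := norm_mul_le _ _ _ _ hE hs.
have := norm_mul_le _ _ _ _ hE1 yr.
have := ler_normD ((expR x - 1 - x) * cos y) ((1 + x) * (cos y - 1)).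
have := ler_normD (expR x * (sin y - y)) ((expR x - 1) * y).
nra.
Qed.

(** The addition law carries the estimate at 0 over to z, at the cost of a factor |cexp z|; the
    tolerance is divided by |cexp z| + 1 to absorb it. *)
Lemma is_derive_cexp z : is_derive z 1 (@cexp R) (cexp z).
Proof.
apply/is_derive1P => e e0; have c0 : 0 < `|cexp z| + 1 by rewrite ltr_wpDl.
have /is_derive1P/(_ _ (divr_gt0 e0 c0))[d d0 dH] := is_derive_cexp0.
exists d => // h /dH; rewrite addr0 cexp0 mul1r cexpD => {}dH.
have -> : cexp h * cexp z - cexp z - cexp z * h = cexp z * (cexp h - 1 - h).
  by rewrite !mulrBr mulr1 [cexp h * _]mulrC.
rewrite normrM; apply: le_trans (ler_wpM2l (normr_ge0 _) dH) _.
rewrite mulrA ler_wpM2r// mulrCA ler_piMr ?(ltW e0)//.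
by rewrite ler_pdivrMr// mul1r lerDl.
Qed.

End complex_exponential.

(** * Chain rule and iterated derivatives on an open set *)

Lemma scale_numFieldE (K : numFieldType) (a : K) (b : (K : normedModType K)) :
  a *: b = a * b.
Proof. by []. Qed.

Section chain_rule.
Context {K : numFieldType}.
Implicit Types f g : K -> K.

Lemma is_derive1_comp_numField f g (x a b : K) :
  is_derive (g x) 1 f a -> is_derive x 1 g b -> is_derive x 1 (f \o g) (a * b).
Proof.
move=> [df <-] [dg <-].
have /derivable1_diffP Df := df; have /derivable1_diffP Dg := dg.
split; first exact/derivable1_diffP/differentiable_comp.
rewrite -!derive1E derive1E'; last exact: differentiable_comp.
rewrite (diff_comp Dg Df) [LHS]/= (deriv1E df) (deriv1E dg).
by rewrite !scale_numFieldE mul1r mulrC.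
Qed.

Lemma iter_derive1_open (U : set K) (D : nat -> K -> K) f :
  open U -> (forall z, U z -> f z = D 0%N z) ->
  (forall j z, U z -> is_derive z 1 (D j) (D j.+1 z)) ->
  forall j z, U z -> f^`(j) z = D j z /\ derivable f^`(j) z 1.
Proof.
move=> oU f0 dD.
have Dderive j : (forall z, U z -> f^`(j) z = D j z) ->
    forall z, U z -> is_derive z 1 f^`(j) (D j.+1 z).
  move=> fj z Uz; apply: (@near_eq_is_derive _ _ _ (D j)) (dD j z Uz).
  by near=> w; rewrite fj//; near: w; exact: open_nbhs_nbhs.
have fD j : forall z, U z -> f^`(j) z = D j z.
  elim: j => [|j IH] z Uz; first exact: f0.
  by rewrite derive1nS derive1E; have [] := Dderive _ IH z Uz.
move=> j z Uz; split; first exact: fD.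
by have [] := Dderive _ (fD j) z Uz.
Unshelve. all: by end_near. Qed.

End chain_rule.

(** Collects like powers after differentiation: T l receives b l from its own summand and c (l - 1)
    from the previous one. At the two end indices only one contribution exists. *)
Lemma sum_shift_split (K : pzRingType) k (b c a T : nat -> K) :
  a 0%N = b 0%N -> (forall l, (l < k)%N -> a l.+1 = b l.+1 + c l) ->
  a k.+1 = c k ->
  \sum_(l < k.+1) (b l * T l + c l * T l.+1) = \sum_(l < k.+2) a l * T l.
Proof.
move=> a0 aS ak; rewrite big_split/= [in RHS]big_ord_recl/= a0.
rewrite [\sum_(l < k.+1) b _ * _]big_ord_recl -addrA; congr (_ + _).
rewrite [\sum_(l < k.+1) c _ * _]big_ord_recr [in RHS]big_ord_recr/= ak.
rewrite addrA -big_split/=; congr (_ + _); apply: eq_bigr => l _.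
by rewrite aS// mulrDl.
Qed.

(** * Term-by-term differentiation for abstract sine and cosine *)

Section cosecant_derivatives.
Context {K : numFieldType} {p : K} {S C : K -> K}.
Implicit Types (m k l n : nat) (z : K).
Hypothesis dS : forall z : K, is_derive z 1 S (p * C z).
Hypothesis dC : forall z : K, is_derive z 1 C (- (p * S z)).
Hypothesis SC : forall z : K, C z ^+ 2 + S z ^+ 2 = 1.

Lemma is_derive_invX n z : S z != 0 ->
  is_derive z 1 (fun w => (S w ^+ n)^-1) (- (p * n%:R * C z / S z ^+ n.+1)).
Proof.
move=> S0; have dX := is_deriveX n (dS z).
have Sn0 : (S ^+ n) z != 0 by rewrite exprfctE expf_neq0.
have [dV eV] := (derivableV Sn0 (@ex_derive _ _ _ _ _ _ _ dX),
                 deriveV Sn0 (@ex_derive _ _ _ _ _ _ _ dX)).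
have -> : (fun w => (S w ^+ n)^-1) = (fun w => ((S ^+ n) w)^-1).
  by apply/funext => w; rewrite exprfctE.
split; first exact: dV.
rewrite eV (@derive_val _ _ _ _ _ _ _ dX) exprfctE.
case: n {dX Sn0 dV eV} => [|n]; first by rewrite !(mulr0, mul0r, scale0r, scaler0, oppr0).
rewrite !scale_numFieldE /= !exprS.
have Sn0 : S z ^+ n != 0 by rewrite expf_neq0.
by field; rewrite S0 Sn0.
Qed.

Lemma is_derive_cos_invX n z : S z != 0 ->
  is_derive z 1 (fun w => C w / S w ^+ n.+1)
    (p * (n%:R / S z ^+ n - n.+1%:R / S z ^+ n.+2)).
Proof.
move=> S0; have := is_deriveM (dC z) (is_derive_invX n.+1 z S0).
rewrite mulrfctE => dM; apply: (is_derive_eq dM).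
rewrite !scale_numFieldE.
have C2 : C z ^+ 2 = 1 - S z ^+ 2 by rewrite -(SC z) addrK.
have Sn0 : S z ^+ n != 0 by rewrite expf_neq0.
transitivity (- (p * n.+1%:R * C z ^+ 2 / S z ^+ n.+2) - p / S z ^+ n).
  by rewrite !exprS expr0; field; rewrite S0 Sn0.
by rewrite C2 !exprS expr0 -[n.+1%:R]natr1; field; rewrite S0 Sn0.
Qed.

(** Here [m] stands for the m - 1 of the theorem, which keeps truncated subtraction out of the
    factorials and of the exponents of S. *)
Definition cosec_coef (m k l : nat) : K :=
  (2 * (m + l))`!%:R / (2 * m)`!%:R *
  (complete_homogeneous (fun h => (2 * (m + h)).+1 ^ 2)%N l (k - l))%:R *
  (-1) ^+ (k - l).

Definition cosec_derive_even m k z : K :=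
  p ^+ (2 * k) *
  \sum_(l < k.+1) cosec_coef m k l * (S z ^+ (2 * (m + l)).+1)^-1.

Definition cosec_derive_odd m k z : K :=
  p ^+ (2 * k).+1 *
  \sum_(l < k.+1) - ((2 * (m + l)).+1%:R * cosec_coef m k l) *
    (C z / S z ^+ (2 * (m + l)).+2).

Lemma cosec_coefS0 m k :
  cosec_coef m k.+1 0 = - ((2 * (m + 0)).+1%:R ^+ 2 * cosec_coef m k 0).
Proof.
rewrite /cosec_coef /= !subn0 exprS !expnS natrM natrX -[(_ ^ 0)%N]/1%N.
by rewrite muln1 natrM expr2; ring.
Qed.

Lemma cosec_coef_fact m l :
  (2 * (m + l.+1))`!%:R / (2 * m)`!%:R =
  (2 * (m + l)).+2%:R * (2 * (m + l)).+1%:R *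
    ((2 * (m + l))`!%:R / (2 * m)`!%:R) :> K.
Proof.
have -> : (2 * (m + l.+1) = (2 * (m + l)).+2)%N by lia.
by rewrite !factS !natrM !mulrA.
Qed.

Lemma cosec_coefSS m k l : (l < k)%N ->
  cosec_coef m k.+1 l.+1 =
    - ((2 * (m + l.+1)).+1%:R ^+ 2 * cosec_coef m k l.+1) +
    (2 * (m + l)).+2%:R * (2 * (m + l)).+1%:R * cosec_coef m k l.
Proof.
move=> lk; rewrite /cosec_coef subSS -[(k - l)%N](subnSK lk).
rewrite complete_homogeneousSS cosec_coef_fact natrD natrM natrX.
rewrite ![(-1) ^+ _.+1]exprS; move: (_ / _) ((-1) ^+ _) => x e; ring.
Qed.

(** Separate from [cosec_coefSS] because k - (k + 1) truncates to 0, so [cosec_coef m k k.+1] is not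
    zero as the recurrence would require. *)
Lemma cosec_coefkk m k :
  cosec_coef m k.+1 k.+1 =
    (2 * (m + k)).+2%:R * (2 * (m + k)).+1%:R * cosec_coef m k k.
Proof.
by rewrite /cosec_coef !subnn !complete_homogeneous0 cosec_coef_fact !mulr1.
Qed.

Lemma is_derive_cosec_even m k z : S z != 0 ->
  is_derive z 1 (cosec_derive_even m k) (cosec_derive_odd m k z).
Proof.
move=> S0.
have -> : cosec_derive_even m k = p ^+ (2 * k) \*:
    \sum_(l < k.+1) (cosec_coef m k l \*: fun w => (S w ^+ (2 * (m + l)).+1)^-1).
  by apply/funext => w; rewrite /cosec_derive_even /= fct_sumE.
apply: is_derive_eq.
  apply: is_deriveZ; apply: is_derive_sum => l; apply: is_deriveZ.
  exact: is_derive_invX.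
rewrite /cosec_derive_odd exprSr !scale_numFieldE -mulrA; congr (_ * _).
rewrite mulr_sumr; apply: eq_bigr => l _.
by rewrite !scale_numFieldE; move: (cosec_coef _ _ _) (_ ^-1) => a b; ring.
Qed.

Lemma is_derive_cosec_odd m k z : S z != 0 ->
  is_derive z 1 (cosec_derive_odd m k) (cosec_derive_even m k.+1 z).
Proof.
move=> S0.
have -> : cosec_derive_odd m k = p ^+ (2 * k).+1 \*:
    \sum_(l < k.+1) (- ((2 * (m + l)).+1%:R * cosec_coef m k l) \*:
      fun w => C w / S w ^+ (2 * (m + l)).+2).
  by apply/funext => w; rewrite /cosec_derive_odd /= fct_sumE.
apply: is_derive_eq.
  apply: is_deriveZ; apply: is_derive_sum => l; apply: is_deriveZ.
  exact: is_derive_cos_invX.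
(* With N = 2(m + l) + 1, the derivative of C / S^(N+1) involves 1 / S^N = T l and 1 / S^(N+2) = T
   (l + 1). The factor -N [cosec_coef m k l] turns their coefficients N and -(N+1) into the b l and
   c l of [sum_shift_split]. *)
pose T l := (S z ^+ (2 * (m + l)).+1)^-1.
have TS l : (S z ^+ (2 * (m + l)).+3)^-1 = T l.+1.
  by rewrite /T; congr (_ ^- _); lia.
rewrite /cosec_derive_even mulnS add2n [in RHS]exprSr !scale_numFieldE -mulrA.
congr (_ * _); rewrite -(@sum_shift_split _ k
  (fun l => - ((2 * (m + l)).+1%:R ^+ 2 * cosec_coef m k l))
  (fun l => (2 * (m + l)).+2%:R * (2 * (m + l)).+1%:R * cosec_coef m k l)
  (cosec_coef m k.+1) T (cosec_coefS0 m k) (@cosec_coefSS m k) (cosec_coefkk m k)).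
rewrite mulr_sumr; apply: eq_bigr => l _.
rewrite scale_numFieldE TS -/(T l).
by move: (cosec_coef _ _ _) (T l) (T l.+1) => a t t'; ring.
Qed.

End cosecant_derivatives.

(** * Complex sine and cosine *)

Section complex_trigonometry.
Local Open Scope complex_scope.
Context {R : realType}.
Implicit Types z w c : Cplx R.

Lemma cI2 : cI R * cI R = -1.
Proof. by rewrite -expr2; exact: sqr_i. Qed.

Lemma cI_neq0 : cI R != 0.
Proof. by rewrite eq_complex /= oner_eq0 andbF. Qed.

Lemma is_derive_mull c z : is_derive z 1 (fun w => c * w) c.
Proof.
by have := is_deriveZ c (is_derive_id z (1 : Cplx R)); rewrite scale_numFieldE mulr1.
Qed.

Lemma is_derive_cexpMl c z :
  is_derive z 1 (fun w => cexp (c * w)) (c * cexp (c * z)).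
Proof.
rewrite mulrC; apply: (@is_derive1_comp_numField _ (@cexp R) (fun w => c * w)).
  exact: is_derive_cexp.
exact: is_derive_mull.
Qed.

Lemma is_derive_csin z : is_derive z 1 (@csin R) (ccos z).
Proof.
have -> : @csin R = (2%:R * cI R)^-1 \*:
    ((fun w => cexp (cI R * w)) - (fun w => cexp (- cI R * w))).
  by apply/funext => w; rewrite /csin -(mulNr (cI R)) [LHS]mulrC.
apply: (is_derive_eq (is_deriveZ _ (is_deriveB
  (is_derive_cexpMl (cI R) z) (is_derive_cexpMl (- cI R) z)))).
rewrite scale_numFieldE /ccos !(mulNr (cI R)).
have alg (K : numFieldType) (I a b : K) :
    I != 0 -> (2%:R * I)^-1 * (I * a - - (I * b)) = (a + b) / 2%:R.
  by move=> I0; field.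
exact/alg/cI_neq0.
Qed.

Lemma is_derive_ccos z : is_derive z 1 (@ccos R) (- csin z).
Proof.
have -> : @ccos R = 2%:R^-1 \*:
    ((fun w => cexp (cI R * w)) + (fun w => cexp (- cI R * w))).
  by apply/funext => w; rewrite /ccos -(mulNr (cI R)) [LHS]mulrC.
apply: (is_derive_eq (is_deriveZ _ (is_deriveD
  (is_derive_cexpMl (cI R) z) (is_derive_cexpMl (- cI R) z)))).
rewrite scale_numFieldE /csin invfM.
have alg (K : numFieldType) (I a b : K) :
    2%:R^-1 * (I * a + - (I * b)) = - ((a - b) * (2%:R^-1 * - I)) by ring.
have -> : (cI R)^-1 = - cI R.
  by apply: (mulfI cI_neq0); rewrite mulfV ?cI_neq0// mulrN cI2 opprK.
by rewrite !(mulNr (cI R)); exact: alg.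
Qed.

(** With a = exp(iz) and b = exp(-iz), the left side is ((a + b)^2 - (a - b)^2) / 4 = ab = 1. *)
Lemma ccos2Dcsin2 z : ccos z ^+ 2 + csin z ^+ 2 = 1.
Proof.
rewrite /ccos /csin !expr_div_n exprMn [cI R ^+ 2]expr2 cI2.
have : cexp (cI R * z) * cexp (- (cI R * z)) = 1 by rewrite -cexpD subrr cexp0.
have alg (K : numFieldType) (a b : K) :
    a * b = 1 -> (a + b) ^+ 2 / 2%:R ^+ 2 + (a - b) ^+ 2 / (2%:R ^+ 2 * -1) = 1.
  by move=> ab; transitivity (a * b) => //; field.
exact: alg.
Qed.

(** A zero z = x + iy gives exp(i pi z) = exp(-i pi z). The imaginary parts force sin (pi x) = 0, as
    exp(pi y) + exp(-pi y) > 0. Then cos (pi x) is nonzero, so the real parts give y = 0, and x is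
    an integer. *)
Lemma csin_pi_neq0 z : (forall n : int, z <> n%:~R) -> csin (cpi R * z) != 0.
Proof.
case: z => x y hz; rewrite mulf_neq0 ?invr_neq0 ?mulf_neq0 ?pnatr_eq0 ?cI_neq0//.
have -> : cI R * (cpi R * (x +i* y)) = (- (pi * y)) +i* (pi * x).
  by apply/eqP; rewrite eq_complex/=; apply/andP; split; apply/eqP; ring.
have -> : - ((- (pi * y)) +i* (pi * x) : Cplx R) = (pi * y) +i* (- (pi * x)).
  by apply/eqP; rewrite eq_complex/= opprK !eqxx.
rewrite !cexpE subr_eq0 eq_complex /= cosN sinN; apply/negP => /andP[/eqP cE /eqP sE].
have sx0 : sin (pi * x) = 0.
  have := expR_gt0 (pi * y); have := expR_gt0 (- (pi * y)); nra.
have cx0 : cos (pi * x) != 0.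
  by rewrite -normr_eq0 (sin0cos1 sx0) oner_eq0.
have y0 : y = 0.
  move/(mulIf cx0)/expR_inj/eqP: cE; rewrite -subr_eq0 -opprD oppr_eq0 -mulr2n.
  by rewrite mulrn_eq0/= mulf_eq0 gt_eqF ?pi_gt0//= => /eqP.
have [n xn] := sin_pi_eq0 R x sx0.
by apply: (hz n); rewrite -(rmorph_int (real_complex R)) -xn y0.
Qed.

Definition csinpi z : Cplx R := csin (cpi R * z).
Definition ccospi z : Cplx R := ccos (cpi R * z).

Lemma is_derive_csin_pi z : is_derive z 1 csinpi (cpi R * ccospi z).
Proof.
rewrite mulrC; apply: (@is_derive1_comp_numField _ (@csin R) (fun w => cpi R * w)).
  exact: is_derive_csin.
exact: is_derive_mull.
Qed.

Lemma is_derive_ccos_pi z : is_derive z 1 ccospi (- (cpi R * csinpi z)).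
Proof.
rewrite mulrC -mulNr.
exact: (is_derive1_comp_numField _ _ _ _ _ (is_derive_ccos (cpi R * z))
  (is_derive_mull (cpi R) z)).
Qed.

Lemma open_csin_pi_neq0 : open [set z | csinpi z != 0].
Proof.
rewrite openE => z s0.
have sz : csinpi w @[w --> z] --> csinpi z.
  apply/differentiable_continuous/derivable1_diffP.
  by have [] := is_derive_csin_pi z.
exact: (cvgr_neq0 (csinpi z) sz s0).
Qed.

End complex_trigonometry.

(** * Both formulas as one sequence indexed by the order of the derivative *)

Definition cosec_pi_derive (R : realType) m j : Cplx R -> Cplx R :=
  if odd j then @cosec_derive_odd _ (cpi R) csinpi ccospi m j./2
  else @cosec_derive_even _ (cpi R) csinpi m j./2.

Lemma is_derive_cosec_pi (R : realType) m j (z : Cplx R) :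
  csinpi z != 0 ->
  is_derive z 1 (cosec_pi_derive R m j) (cosec_pi_derive R m j.+1 z).
Proof.
move=> s0; rewrite /cosec_pi_derive /= uphalf_half.
case: (odd j) => /=; rewrite ?add1n ?add0n.
  exact: (is_derive_cosec_odd (@is_derive_csin_pi R) (@is_derive_ccos_pi R)
    (fun w => ccos2Dcsin2 (cpi R * w))).
exact: (is_derive_cosec_even (@is_derive_csin_pi R)).
Qed.

(* The total operator f^`(n) is the n-th derivative only where it exists, so
   the existence of the derivatives up to order 2k + 1 at s is stated too. *)
Theorem theorem2p2 (R : realType) (k m : nat) (hm : (1 <= m)%N) (s : Cplx R)
    (hs : forall n : int, s <> n%:~R) :
  let f : Cplx R -> Cplx R := fun z => 1 / csin (cpi R * z) ^+ (2 * m - 1) in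
  [/\ forall j : nat, (j <= 2 * k)%N -> derivable f^`(j) s 1,
      f^`(2 * k) s =
        cpi R ^+ (2 * k) *
        \sum_(l < k.+1)
          ((2 * m + 2 * l - 2)`!%:R / (2 * m - 2)`!%:R *
             (odd_power_sum m l (k - l))%:R) *
          ((-1) ^+ (k - l) / csin (cpi R * s) ^+ (2 * m + 2 * l - 1))
    & f^`(2 * k + 1) s =
        cpi R ^+ (2 * k + 1) *
        \sum_(l < k.+1)
          ((2 * m + 2 * l - 1)`!%:R / (2 * m - 2)`!%:R *
             (odd_power_sum m l (k - l))%:R) *
          ((-1) ^+ (k + 1 - l) * ccos (cpi R * s) /
             csin (cpi R * s) ^+ (2 * m + 2 * l))].
Proof.
case: m hm => // m _ f; have s0 := csin_pi_neq0 s hs.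
have eM : (2 * m.+1 - 1 = (2 * m).+1)%N by lia.
have eM2 : (2 * m.+1 - 2 = 2 * m)%N by lia.
have e0 l : (2 * m.+1 + 2 * l - 2 = 2 * (m + l))%N by lia.
have e1 l : (2 * m.+1 + 2 * l - 1 = (2 * (m + l)).+1)%N by lia.
have e2 l : (2 * m.+1 + 2 * l = (2 * (m + l)).+2)%N by lia.
have hE l n : odd_power_sum m.+1 l n =
    complete_homogeneous (fun h => (2 * (m + h)).+1 ^ 2)%N l n.
  by rewrite odd_power_sumE; congr complete_homogeneous; apply/funext => h; rewrite e1.
(* Only order 0 remains to be checked: its sum has the single term l = 0, with coefficient 1. *)
have fD : forall j z, csinpi z != 0 ->
    f^`(j) z = cosec_pi_derive R m j z /\ derivable f^`(j) z 1.
  apply: iter_derive1_open open_csin_pi_neq0 _ (is_derive_cosec_pi R m) => z _.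
  rewrite /f /cosec_pi_derive /cosec_derive_even /= muln0 expr0 mul1r big_ord1.
  rewrite /cosec_coef /= subnn addn0 eM divff ?pnatr_eq0 -?lt0n ?fact_gt0//.
  by rewrite !mul1r.
split=> [j _||]; first by have [] := fD j s s0.
- have [-> _] := fD (2 * k)%N s s0.
  rewrite /cosec_pi_derive oddM /= mul2n doubleK /cosec_derive_even mul2n.
  congr (_ * _); apply: eq_bigr => l _.
  by rewrite /cosec_coef e0 e1 eM2 hE !mulrA.
- have [-> _] := fD (2 * k + 1)%N s s0.
  rewrite addn1 /cosec_pi_derive /= oddM /= uphalf_half oddM /= add0n mul2n doubleK.
  rewrite /cosec_derive_odd mul2n; congr (_ * _); apply: eq_bigr => l _.
  (* The factor 2(m + l) + 1 of the odd formula is absorbed into the factorial by [factS], and its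
     minus sign raises the exponent of -1 to k + 1 - l. *)
  have kl : (k + 1 - l = (k - l).+1)%N by rewrite addn1 subSn// -ltnS.
  have alg (K : numFieldType) (n F G H e c d : K) :
      - (n * (F / G * H * e)) * (c / d) = n * F / G * H * (-1 * e * c / d).
    by ring.
  rewrite /cosec_coef e1 e2 eM2 hE kl (factS (2 * (m + l))) natrM (exprS (-1)).
  exact: alg.
Qed.
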